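(* Let $F$ be a field. The universal grading group functors $$R\colon \widetilde{\mathbf{GrAlg}_F}\to\mathbf{Grp}\quad\text{and}\quad R_1\colon \widetilde{\mathbf{GrAlg}^1_F}\to\mathbf{Grp}$$ admit neither left nor right adjoints.
   Context: Algebras are associative over the field $F$, not necessarily unital or commutative. A grading on an algebra $A$ by a group $G$ is a decomposition $\Gamma\colon A=\bigoplus_{g\in G}A^{(g)}$ into a direct sum of subspaces with $A^{(g)}A^{(h)}\subseteq A^{(gh)}$ for all $g,h\in G$; its support is $\operatorname{supp}\Gamma=\{g\in G\mid A^{(g)}\neq 0\}$. A homomorphism of algebras $\psi\colon A\to B$ between algebras graded by groups $G$ and $H$ (possibly different) is graded if for every $g\in G$ there exists $h\in H$ with $\psi(A^{(g)})\subseteq B^{(h)}$. A graded homomorphism is graded injective if its restriction to each homogeneous component $A^{(g)}$ is injective. $\widetilde{\mathbf{GrAlg}_F}$ is the category whose objects are all gradings by arbitrary groups on (not necessarily unital) associative $F$-algebras and whose morphisms are the graded injective homomorphisms. $\widetilde{\mathbf{GrAlg}^1_F}$ is the category whose objects are all group gradings on unital associative $F$-algebras and whose morphisms are the unital graded injective homomorphisms. $\mathbf{Grp}$ is the category of groups. The universal group $G_\Gamma$ of a grading $\Gamma\colon A=\bigoplus_{g\in G}A^{(g)}$ is the group $\mathcal F([\operatorname{supp}\Gamma])/N$, where $\mathcal F([\operatorname{supp}\Gamma])$ is the free group on the set of symbols $\{[g]\mid g\in\operatorname{supp}\Gamma\}$ and $N$ is the normal closure of the words $[g][h][gh]^{-1}$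 for all $g,h\in\operatorname{supp}\Gamma$ with $A^{(g)}A^{(h)}\neq 0$. (Equivalently, $\Gamma$ can be realized as a $G_\Gamma$-grading with embedding $\varkappa_\Gamma\colon\operatorname{supp}\Gamma\hookrightarrow G_\Gamma$, and for any realization of $\Gamma$ as a grading by a group $G'$ with embedding of the support $\psi\colon\operatorname{supp}\Gamma\hookrightarrow G'$ there is a unique group homomorphism $\varphi\colon G_\Gamma\to G'$ with $\varphi\varkappa_\Gamma=\psi$.) The functor $R$ is defined by $R(\Gamma):=G_\Gamma$ on objects; for a graded injective homomorphism $\varphi$ from $\Gamma\colon A=\bigoplus_{g\in G}A^{(g)}$ to $\Gamma_1\colon B=\bigoplus_{h\in H}B^{(h)}$, the group homomorphism $R(\varphi)\colon G_\Gamma\to G_{\Gamma_1}$ sends the generator corresponding to $g\in\operatorname{supp}\Gamma$ to the generator corresponding to the unique $h\in\operatorname{supp}\Gamma_1$ with $\varphi(A^{(g)})\subseteq B^{(h)}$. The functor $R_1$ is the restriction of $R$ to $\widetilde{\mathbf{GrAlg}^1_F}$. *)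

(* Defs.v *)
From HB Require Import structures.
From mathcomp Require Import all_boot all_algebra.
From mathcomp Require Import boolp classical_sets functions cardinality fsbigop.

Set Implicit Arguments.
Unset Strict Implicit.
Unset Printing Implicit Defensive.

Import GRing.Theory.

Local Open Scope classical_set_scope.
Local Open Scope group_scope.

Record category := Category {
  object :> Type;
  hom : object -> object -> Type;
  idm : forall X, hom X X;
  compm : forall X Y Z, hom Y Z -> hom X Y -> hom X Z;
  comp_idl : forall X Y (f : hom X Y), compm (idm Y) f = f;
  comp_idr : forall X Y (f : hom X Y), compm f (idm X) = f;
  compmA : forall X Y Z T (h : hom Z T) (g : hom Y Z) (f : hom X Y),
    compm h (compm g f) = compm (compm h g) f }.

Arguments hom {_} _ _.
Arguments idm {_} _.
Arguments compm {_ _ _ _} _ _.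

Record functor (C D : category) := Functor {
  fobj :> C -> D;
  fmap : forall X Y : C, hom X Y -> hom (fobj X) (fobj Y);
  fmap_id : forall X : C, fmap (idm X) = idm (fobj X);
  fmap_comp : forall (X Y Z : C) (g : hom Y Z) (f : hom X Y),
    fmap (compm g f) = compm (fmap g) (fmap f) }.

Arguments fmap {C D} _ {X Y} _.

Definition functor_comp (C D E : category) (S : functor D E) (T : functor C D) :
  functor C E.
Proof.
apply: (@Functor C E (fun X => S (T X)) (fun X Y f => fmap S (fmap T f))).
- by move=> X; rewrite !fmap_id.
- by move=> X Y Z g f; rewrite !fmap_comp.
Defined.

Definition adjoint (C D : category) (L : functor C D) (R : functor D C) : Prop :=
  exists phi : forall (X : C) (Y : D), hom (L X) Y -> hom X (R Y),
    (forall X Y, bijective (phi X Y)) /\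
    (forall (X X' : C) (Y Y' : D)
            (f : hom X' X) (h : hom (L X) Y) (g : hom Y Y'),
       phi X' Y' (compm g (compm h (fmap L f))) =
       compm (fmap R g) (compm (phi X Y h) f)).

Definition has_left_adjoint (C D : category) (R : functor D C) : Prop :=
  exists L : functor C D, adjoint L R.

Definition has_right_adjoint (C D : category) (L : functor C D) : Prop :=
  exists R : functor D C, adjoint L R.

Notation group_hom := UMagmaMorphism.type.

Lemma group_hom_eq (G H : groupType) (f g : group_hom G H) : f =1 g -> f = g.
Proof.
case: f => f [[f1] [fM]]; case: g => g [[g1] [gM]] /= /funext fg.
case: _ / fg g1 gM => g1 gM.
by rewrite (Prop_irrelevance f1 g1) (Prop_irrelevance fM gM).
Qed.

Lemma morphM1 (G H : groupType) (f : G -> H) :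
  {morph f : x y / x * y} -> f 1 = 1.
Proof. by move=> fM; apply: (@mulgI _ (f 1)); rewrite -fM !mulg1. Qed.

(* [groupType] carries a choice operator; by choice every group has one, and
   homomorphisms ignore it, so up to equivalence this is the category of all
   groups. *)
Definition Grp : category.
Proof.
apply: (@Category groupType (fun G H => group_hom G H)
  (fun G => idfun) (fun G H K g f => g \o f)).
- by move=> G H f; apply: group_hom_eq.
- by move=> G H f; apply: group_hom_eq.
- by move=> G H K L h g f; apply: group_hom_eq.
Defined.

Section QuotientGroup.
Variable G : groupType.

Record normal_set (N : set G) : Prop := NormalSet {
  normal1 : N 1;
  normalM : forall x y, N x -> N y -> N (x * y);
  normalV : forall x, N x -> N x^-1;
  normalJ : forall x y, N x -> N (x ^ y) }.

Definition normal_closure (S : set G) : set G :=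
  [set x | forall N : set G, normal_set N -> S `<=` N -> N x].

Lemma normal_closureP S : normal_set (normal_closure S).
Proof.
split.
- by move=> N NP _; apply: normal1 NP.
- by move=> x y Sx Sy N NP SN; apply: (normalM NP); [apply: Sx | apply: Sy].
- by move=> x Sx N NP SN; apply: (normalV NP); apply: Sx.
- by move=> x y Sx N NP SN; apply: (normalJ NP); apply: Sx.
Qed.

Lemma sub_normal_closure (S : set G) : S `<=` normal_closure S.
Proof. by move=> x Sx N _; apply. Qed.

Lemma kernel_normal (H : groupType) (f : group_hom G H) :
  normal_set [set x | f x = 1].
Proof.
split=> [|x y /= fx fy|x /= fx|x y /= fx].
- exact: gmulf1.
- by rewrite gmulfM fx fy mulg1.
- by rewrite gmulfV fx invg1.
- by rewrite gmulfJ fx conj1g.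
Qed.

Variables (N : set G) (nP : normal_set N).

Definition coset_rel : rel G := fun x y => `[< N (x^-1 * y) >].

Lemma coset_rel_refl : reflexive coset_rel.
Proof. by move=> x; apply/asboolP; rewrite mulVg; apply: normal1 nP. Qed.

Lemma coset_rel_sym : symmetric coset_rel.
Proof.
by move=> x y; apply/asboolP/asboolP => /(normalV nP); rewrite invgM invgK.
Qed.

Lemma coset_rel_trans : transitive coset_rel.
Proof.
move=> y x z /asboolP xy /asboolP yz; apply/asboolP.
by have := normalM nP xy yz; rewrite -mulgA mulVKg.
Qed.

Canonical coset_equiv :=
  EquivRel coset_rel coset_rel_refl coset_rel_sym coset_rel_trans.

Definition quotient_group := {eq_quot coset_equiv}%qT.

HB.instance Definition _ := Choice.on quotient_group.

Definition quotient_pi (x : G) : quotient_group := \pi%qT x.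
Definition quotient_repr (q : quotient_group) : G := repr q.
Definition quotient_mul (p q : quotient_group) : quotient_group :=
  quotient_pi (quotient_repr p * quotient_repr q).
Definition quotient_inv (p : quotient_group) : quotient_group :=
  quotient_pi (quotient_repr p)^-1.

Lemma quotient_reprK q : quotient_pi (quotient_repr q) = q.
Proof. exact: reprK. Qed.

Lemma quotient_piP x y : quotient_pi x = quotient_pi y <-> N (x^-1 * y).
Proof.
by split=> [/eqmodP /asboolP | xy] //; apply/eqmodP/asboolP.
Qed.

Lemma quotient_mulE x y :
  quotient_mul (quotient_pi x) (quotient_pi y) = quotient_pi (x * y).
Proof.
apply/quotient_piP; set x' := quotient_repr _; set y' := quotient_repr _.
have /quotient_piP xx' : quotient_pi x' = quotient_pi x by apply: quotient_reprK.
have /quotient_piP yy' : quotient_pi y' = quotient_pi y by apply: quotient_reprK.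
have -> : (x' * y')^-1 * (x * y) = ((x'^-1 * x) ^ y') * (y'^-1 * y).
  by rewrite conjgE invgM !mulgA mulgK.
by apply: normalM => //; apply: normalJ.
Qed.

Lemma quotient_invE x : quotient_inv (quotient_pi x) = quotient_pi x^-1.
Proof.
apply/quotient_piP; set x' := quotient_repr _.
have /quotient_piP xx' : quotient_pi x' = quotient_pi x by apply: quotient_reprK.
have -> : x'^-1^-1 * x^-1 = ((x'^-1 * x)^-1) ^ x'^-1.
  by rewrite conjgE invgM !invgK mulgK.
by apply: normalJ => //; apply: normalV.
Qed.

Lemma quotient_mulA : associative quotient_mul.
Proof.
move=> p q r; rewrite -(quotient_reprK p) -(quotient_reprK q).
by rewrite -(quotient_reprK r) !quotient_mulE mulgA.
Qed.

Lemma quotient_mul1 : left_id (quotient_pi 1) quotient_mul.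
Proof. by move=> p; rewrite -(quotient_reprK p) quotient_mulE mul1g. Qed.

Lemma quotient_mulr1 : right_id (quotient_pi 1) quotient_mul.
Proof. by move=> p; rewrite -(quotient_reprK p) quotient_mulE mulg1. Qed.

Lemma quotient_mulV : left_inverse (quotient_pi 1) quotient_inv quotient_mul.
Proof.
by move=> p; rewrite -(quotient_reprK p) quotient_invE quotient_mulE mulVg.
Qed.

Lemma quotient_mulrV : right_inverse (quotient_pi 1) quotient_inv quotient_mul.
Proof.
by move=> p; rewrite -(quotient_reprK p) quotient_invE quotient_mulE mulgV.
Qed.

HB.instance Definition _ := isGroup.Build quotient_group quotient_mulA
  quotient_mul1 quotient_mulr1 quotient_mulV quotient_mulrV.

Lemma quotient_pi_is_multiplicative : {morph quotient_pi : x y / x * y}.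
Proof. by move=> x y; rewrite -quotient_mulE. Qed.

HB.instance Definition _ :=
  monoid.isMultiplicative.Build G quotient_group quotient_pi
    quotient_pi_is_multiplicative.
HB.instance Definition _ :=
  Multiplicative_isUMagmaMorphism.Build G quotient_group quotient_pi
    (erefl (1 : quotient_group)).

Section Lift.
Variables (H : groupType) (f : group_hom G H).
Hypothesis f_ker : forall x, N x -> f x = 1.

Definition quotient_lift (q : quotient_group) : H := f (quotient_repr q).

Lemma quotient_liftE x : quotient_lift (quotient_pi x) = f x.
Proof.
have /quotient_piP/f_ker : quotient_pi (quotient_repr (quotient_pi x)) =
  quotient_pi x by apply: quotient_reprK.
by rewrite gmulfM gmulfV => /(canRL (mulVKg _)); rewrite mulg1.
Qed.

Lemma quotient_lift_is_multiplicative : {morph quotient_lift : p q / p * q}.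
Proof.
move=> p q; rewrite -(quotient_reprK p) -(quotient_reprK q) -gmulfM.
by rewrite !quotient_liftE gmulfM.
Qed.

End Lift.

End QuotientGroup.

Section FreeGroup.
Variable X : choiceType.

(* The letter (x, false) stands for x and (x, true) for its inverse. *)
Notation word := (seq (X * bool)).

Inductive word_eq : word -> word -> Prop :=
| word_cancel u x b v : word_eq (u ++ [:: (x, b), (x, ~~ b) & v]) (u ++ v)
| word_refl u : word_eq u u
| word_sym u v : word_eq u v -> word_eq v u
| word_trans u v w : word_eq u v -> word_eq v w -> word_eq u w.

Definition word_rel : rel word := fun u v => `[< word_eq u v >].

Lemma word_rel_refl : reflexive word_rel.
Proof. by move=> u; apply/asboolP; apply: word_refl. Qed.

Lemma word_rel_sym : symmetric word_rel.
Proof. by move=> u v; apply/asboolP/asboolP => /word_sym. Qed.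

Lemma word_rel_trans : transitive word_rel.
Proof.
move=> v u w /asboolP uv /asboolP vw; apply/asboolP; exact: word_trans vw.
Qed.

Canonical word_equiv :=
  EquivRel word_rel word_rel_refl word_rel_sym word_rel_trans.

Definition free_group := {eq_quot word_equiv}%qT.

HB.instance Definition _ := Choice.on free_group.

Definition word_inv (u : word) : word :=
  rev [seq (l.1, ~~ l.2) | l <- u].

Definition free_pi (u : word) : free_group := \pi%qT u.
Definition free_repr (p : free_group) : word := repr p.
Definition free_mul (p q : free_group) : free_group :=
  free_pi (free_repr p ++ free_repr q).
Definition free_inv (p : free_group) : free_group :=
  free_pi (word_inv (free_repr p)).
Definition free_gen (x : X) : free_group := free_pi [:: (x, false)].

Lemma free_reprK p : free_pi (free_repr p) = p.
Proof. exact: reprK. Qed.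

Lemma free_piP u v : free_pi u = free_pi v <-> word_eq u v.
Proof. by split=> [/eqmodP /asboolP | uv] //; apply/eqmodP/asboolP. Qed.

Lemma word_eq_catl w u v : word_eq u v -> word_eq (w ++ u) (w ++ v).
Proof.
elim=> {u v} [u x b v | u | u v _ | u v s _ uv _ vs].
- by rewrite !catA; apply: word_cancel.
- exact: word_refl.
- exact: word_sym.
- exact: word_trans vs.
Qed.

Lemma word_eq_catr w u v : word_eq u v -> word_eq (u ++ w) (v ++ w).
Proof.
elim=> {u v} [u x b v | u | u v _ | u v s _ uv _ vs].
- by rewrite -!catA; apply: word_cancel.
- exact: word_refl.
- exact: word_sym.
- exact: word_trans vs.
Qed.

Lemma word_invK : involutive word_inv.
Proof.
move=> u; rewrite /word_inv map_rev revK -map_comp map_id_in // => -[x b] _ /=.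
by rewrite negbK.
Qed.

Lemma word_inv_cat u v : word_inv (u ++ v) = word_inv v ++ word_inv u.
Proof. by rewrite /word_inv map_cat rev_cat. Qed.

Lemma word_eq_inv u v : word_eq u v -> word_eq (word_inv u) (word_inv v).
Proof.
elim=> {u v} [u x b v | u | u v _ | u v s _ uv _ vs].
- rewrite -(cat1s (x, b)) -(cat1s (x, ~~ b)) !word_inv_cat.
  rewrite -!catA {2 3}/word_inv /= negbK; exact: word_cancel.
- exact: word_refl.
- exact: word_sym.
- exact: word_trans vs.
Qed.

Lemma word_mulV u : word_eq (word_inv u ++ u) [::].
Proof.
elim: u => [|[x b] u IHu]; first exact: word_refl.
rewrite -cat1s word_inv_cat -catA /=; apply: word_trans IHu.
by have := word_cancel (word_inv u) x (~~ b) u; rewrite negbK.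
Qed.

Lemma free_mulE u v : free_mul (free_pi u) (free_pi v) = free_pi (u ++ v).
Proof.
apply/free_piP; apply: (@word_trans _ (u ++ free_repr (free_pi v))).
  by apply: word_eq_catr; apply/free_piP; apply: free_reprK.
by apply: word_eq_catl; apply/free_piP; apply: free_reprK.
Qed.

Lemma free_invE u : free_inv (free_pi u) = free_pi (word_inv u).
Proof. by apply/free_piP/word_eq_inv/free_piP; apply: free_reprK. Qed.

Lemma free_mulA : associative free_mul.
Proof.
move=> p q r; rewrite -(free_reprK p) -(free_reprK q) -(free_reprK r).
by rewrite !free_mulE catA.
Qed.

Lemma free_mul1 : left_id (free_pi [::]) free_mul.
Proof. by move=> p; rewrite -(free_reprK p) free_mulE. Qed.

Lemma free_mulr1 : right_id (free_pi [::]) free_mul.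
Proof. by move=> p; rewrite -(free_reprK p) free_mulE cats0. Qed.

Lemma free_mulV : left_inverse (free_pi [::]) free_inv free_mul.
Proof.
move=> p; rewrite -(free_reprK p) free_invE free_mulE.
by apply/free_piP; apply: word_mulV.
Qed.

Lemma free_mulrV : right_inverse (free_pi [::]) free_inv free_mul.
Proof.
move=> p; rewrite -(free_reprK p) free_invE free_mulE; apply/free_piP.
by rewrite -{1}(word_invK (free_repr p)); apply: word_mulV.
Qed.

HB.instance Definition _ := isGroup.Build free_group free_mulA
  free_mul1 free_mulr1 free_mulV free_mulrV.

Section Lift.
Variables (H : groupType) (f : X -> H).

Definition eval_letter (l : X * bool) : H := if l.2 then (f l.1)^-1 else f l.1.
Definition eval_word (u : word) : H := \prod_(l <- u) eval_letter l.

Lemma eval_word_cat u v : eval_word (u ++ v) = eval_word u * eval_word v.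
Proof. by rewrite /eval_word big_cat. Qed.

Lemma eval_word_eq u v : word_eq u v -> eval_word u = eval_word v.
Proof.
elim=> {u v} [u x b v | // | // | u v w _ -> _ -> //].
rewrite !eval_word_cat /eval_word !big_cons /eval_letter /=.
by case: b; rewrite /= ?mulKg ?mulVKg.
Qed.

Definition free_lift (p : free_group) : H := eval_word (free_repr p).

Lemma free_lift_pi u : free_lift (free_pi u) = eval_word u.
Proof. by apply/eval_word_eq/free_piP; apply: free_reprK. Qed.

Lemma free_lift_is_multiplicative : {morph free_lift : p q / p * q}.
Proof.
move=> p q; rewrite -(free_reprK p) -(free_reprK q).
have -> : free_pi (free_repr p) * free_pi (free_repr q) =
  free_pi (free_repr p ++ free_repr q) by rewrite -free_mulE.
by rewrite !free_lift_pi eval_word_cat.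
Qed.

HB.instance Definition _ := monoid.isMultiplicative.Build free_group H free_lift
  free_lift_is_multiplicative.
HB.instance Definition _ :=
  Multiplicative_isUMagmaMorphism.Build free_group H free_lift
    (morphM1 free_lift_is_multiplicative).

Lemma free_liftE x : free_lift (free_gen x) = f x.
Proof. by rewrite free_lift_pi /eval_word big_seq1. Qed.

End Lift.

Lemma free_hom_ext (H : groupType) (f g : group_hom free_group H) :
  (forall x, f (free_gen x) = g (free_gen x)) -> f =1 g.
Proof.
move=> fg p; rewrite -(free_reprK p); elim: (free_repr p) => [|[x b] u IHu].
  by rewrite -[free_pi [::]]/(1 : free_group) !gmulf1.
have -> : free_pi ((x, b) :: u) = free_pi [:: (x, b)] * free_pi u.
  by rewrite -[RHS]/(free_mul _ _) free_mulE.
rewrite !gmulfM {}IHu; congr (_ * _); case: b => //=; last exact: fg.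
have -> : free_pi [:: (x, true)] = (free_gen x)^-1.
  by rewrite -[RHS]/(free_inv _) free_invE.
by rewrite !gmulfV fg.
Qed.

End FreeGroup.

HB.mixin Record Lmodule_isAssocAlgebra (F : fieldType) A of GRing.Lmodule F A := {
  amul : A -> A -> A;
  amulA : associative amul;
  amulDl : left_distributive amul +%R;
  amulDr : right_distributive amul +%R;
  amulZl : forall (c : F) (x y : A), amul (c *: x)%R y = (c *: amul x y)%R;
  amulZr : forall (c : F) (x y : A), amul x (c *: y)%R = (c *: amul x y)%R }.

(* Associative algebras, not necessarily unital, commutative or nonzero
   (the library's [algType] is unital and nonzero). *)
#[short(type="assocAlgType")]
HB.structure Definition AssocAlgebra (F : fieldType) :=
  {A of GRing.Lmodule F A & Lmodule_isAssocAlgebra F A}.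

Section Grading.
Variables (F : fieldType) (G : groupType) (A : assocAlgType F).
Implicit Types V : G -> set A.

Definition subspace (U : set A) : Prop :=
  U 0%R /\ forall (c : F) x y, U x -> U y -> U (c *: x + y)%R.

Definition direct_sum_decomposition V : Prop :=
  forall x : A, exists! f : G -> A,
    [/\ forall g, V g (f g), finite_set (f @^-1` [set~ 0%R])
      & x = (\sum_(g \in [set: G]) f g)%R].

Record grading := Grading {
  component :> G -> set A;
  component_subspace : forall g, subspace (component g);
  component_direct_sum : direct_sum_decomposition component;
  component_mul : forall g h x y,
    component g x -> component h y -> component (g * h) (amul x y) }.

Definition supp (Gamma : grading) : set G := [set g | Gamma g <> [set 0%R]].

(* A^(g) A^(h) <> 0 *)
Definition mul_neq0 (Gamma : grading) (g h : G) : Prop :=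
  exists x y, [/\ Gamma g x, Gamma h y & amul x y <> 0%R].

Lemma suppP (Gamma : grading) g :
  supp Gamma g <-> exists2 x, Gamma g x & x <> 0%R.
Proof.
have [Gamma0 _] := component_subspace Gamma g.
split=> [ng | [x gx x0]]; last by move=> g0; apply: x0; move: gx; rewrite g0.
apply: contra_notP ng => nx; apply/seteqP; split=> x /=; last by move=> ->.
by move=> gx; apply: contra_notP nx => x0; exists x.
Qed.

Lemma mul_neq0_supp (Gamma : grading) g h :
  mul_neq0 Gamma g h -> supp Gamma (g * h).
Proof.
move=> [x [y [gx hy xy]]]; apply/suppP.
by exists (amul x y) => //; apply: component_mul.
Qed.

Lemma component_disjoint (Gamma : grading) g h x :
  Gamma g x -> Gamma h x -> x <> 0%R -> g = h.
Proof.
move=> gx hx x0; apply: contra_notP x0 => gh.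
have [f [_ f_uniq]] := component_direct_sum Gamma x.
pose d (k l : G) : A := (if l == k then x else 0)%R.
have dP k : Gamma k x -> f = d k.
  move=> kx; apply: f_uniq; have subk : d k @^-1` [set~ 0%R] `<=` [set k].
    by move=> l; rewrite /= /d; case: eqP.
  split; last 1 first.
  - rewrite -(fsbig_widen [set k] setT (d k)) //.
      by rewrite fsbig_set1 /d eqxx.
    by move=> l [_ /= lk]; rewrite /d; case: eqP.
  - by move=> l; rewrite /d; case: eqP => [-> //|_];
      have [] := component_subspace Gamma l.
  - exact: sub_finite_set subk (finite_set1 k).
have := dP _ hx; rewrite (dP _ gx) => /(congr1 (@^~ g)).
by rewrite /d eqxx; case: eqP.
Qed.

(* The words [g][h][gh]^-1 for g, h in the support with A^(g) A^(h) <> 0;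
   then gh is in the support as well. *)
Definition universal_relators (Gamma : grading) : set (free_group (supp Gamma)) :=
  [set w | exists g h k : supp Gamma,
     [/\ mul_neq0 Gamma (val g) (val h), val k = val g * val h
       & w = free_gen g * free_gen h * (free_gen k)^-1]].

Arguments universal_relators Gamma : clear implicits.

Definition universal_group (Gamma : grading) : groupType :=
  quotient_group (normal_closureP (universal_relators Gamma)).

Definition universal_gen (Gamma : grading) (g : supp Gamma) :
    universal_group Gamma :=
  quotient_pi _ (free_gen g).

Section Lift.
Variables (Gamma : grading) (H : groupType) (f : supp Gamma -> H).
Hypothesis fM : forall g h k : supp Gamma,
  mul_neq0 Gamma (val g) (val h) -> val k = val g * val h -> f k = f g * f h.

Lemma universal_lift_ker x :
  normal_closure (universal_relators Gamma) x -> free_lift f x = 1.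
Proof.
move=> /(_ _ (kernel_normal (free_lift f))).
apply=> _ [g [h [k [gh kE ->]]]] /=.
by rewrite !gmulfM gmulfV /= !free_liftE (fM gh kE) mulgV.
Qed.

Definition universal_lift : group_hom (universal_group Gamma) H :=
  HB.pack (quotient_lift (free_lift f))
    (monoid.isMultiplicative.Build _ _ _
       (quotient_lift_is_multiplicative universal_lift_ker))
    (Multiplicative_isUMagmaMorphism.Build _ _ _
       (morphM1 (quotient_lift_is_multiplicative universal_lift_ker))).

Lemma universal_liftE g : universal_lift (universal_gen g) = f g.
Proof.
exact: etrans (quotient_liftE _ universal_lift_ker _) (free_liftE _ _).
Qed.

End Lift.

Lemma universal_hom_ext (Gamma : grading) (H : groupType)
    (f g : group_hom (universal_group Gamma) H) :
  (forall x, f (universal_gen x) = g (universal_gen x)) -> f = g.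
Proof.
move=> fg; apply: group_hom_eq => q; rewrite -(quotient_reprK q).
exact: (@free_hom_ext _ _ (f \o quotient_pi _) (g \o quotient_pi _)).
Qed.

End Grading.

Section GradedAlgebras.
Variable F : fieldType.

Record graded_algebra := GradedAlgebra {
  gr_group : groupType;
  gr_algebra : assocAlgType F;
  gr_grading :> grading gr_group gr_algebra }.

Implicit Types Gamma Delta Theta : graded_algebra.

Definition graded_map Gamma Delta (f : gr_algebra Gamma -> gr_algebra Delta) :
    Prop :=
  forall g, exists h, f @` Gamma g `<=` Delta h.

Record graded_injective_hom Gamma Delta := GradedInjectiveHom {
  gr_map :> {linear gr_algebra Gamma -> gr_algebra Delta};
  gr_mapM : {morph gr_map : x y / amul x y};
  gr_map_graded : graded_map gr_map;
  gr_map_inj : forall g, set_inj (Gamma g) gr_map }.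

Lemma graded_injective_hom_eq Gamma Delta
    (f g : graded_injective_hom Gamma Delta) : f =1 g -> f = g.
Proof.
case: f => f fM fgr finj; case: g => g gM ggr ginj /= fg.
have {}fg : f = g.
  case: f g fg {fM fgr finj gM ggr ginj} => f [[[f0 fD]] [fZ]] [g [[[g0 gD]] [gZ]]].
  move=> /= /funext fg; case: _ / fg g0 gD gZ => g0 gD gZ.
  by rewrite (Prop_irrelevance f0 g0) (Prop_irrelevance fD gD)
             (Prop_irrelevance fZ gZ).
case: _ / fg gM ggr ginj => gM ggr ginj.
by rewrite (Prop_irrelevance fM gM) (Prop_irrelevance fgr ggr)
           (Prop_irrelevance finj ginj).
Qed.

Definition gr_id Gamma : graded_injective_hom Gamma Gamma.
Proof.
apply: (@GradedInjectiveHom _ _ idfun) => //.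
by move=> g; exists g => x [y gy <-].
Defined.

Definition gr_comp Gamma Delta Theta (f2 : graded_injective_hom Delta Theta)
    (f1 : graded_injective_hom Gamma Delta) : graded_injective_hom Gamma Theta.
Proof.
apply: (@GradedInjectiveHom _ _ (f2 \o f1)).
- by move=> x y /=; rewrite !gr_mapM.
- move=> g; have [h gh] := gr_map_graded f1 g.
  have [k hk] := gr_map_graded f2 h; exists k => _ [x gx <-].
  by apply: hk; exists (f1 x) => //; apply: gh; exists x.
- move=> g x y gx gy /= /gr_map_inj f12; have [h gh] := gr_map_graded f1 g.
  apply: (gr_map_inj gx gy); apply: (f12 h); rewrite inE; apply: gh.
    by exists x => //; rewrite inE in gx.
  by exists y => //; rewrite inE in gy.
Defined.

Definition GrAlg : category.
Proof.
apply: (@Category graded_algebra graded_injective_hom gr_id gr_comp).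
- by move=> *; apply: graded_injective_hom_eq.
- by move=> *; apply: graded_injective_hom_eq.
- by move=> *; apply: graded_injective_hom_eq.
Defined.

Definition unit_element (A : assocAlgType F) (e : A) : Prop :=
  left_id e amul /\ right_id e amul.

(* The zero algebra counts as unital. *)
Record unital_graded_algebra := UnitalGradedAlgebra {
  unital_gr :> graded_algebra;
  gr_one : gr_algebra unital_gr;
  gr_oneP : unit_element gr_one }.

Record unital_graded_injective_hom (Gamma Delta : unital_graded_algebra) :=
  UnitalGradedInjectiveHom {
    unital_map :> graded_injective_hom Gamma Delta;
    unital_map1 : unital_map (gr_one Gamma) = gr_one Delta }.

Lemma unital_graded_injective_hom_eq (Gamma Delta : unital_graded_algebra)
    (f g : unital_graded_injective_hom Gamma Delta) : f =1 g -> f = g.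
Proof.
case: f => f f1; case: g => g g1 /= /graded_injective_hom_eq fg.
by case: _ / fg g1 => g1; rewrite (Prop_irrelevance f1 g1).
Qed.

Definition unital_id (Gamma : unital_graded_algebra) :
    unital_graded_injective_hom Gamma Gamma :=
  @UnitalGradedInjectiveHom Gamma Gamma (gr_id Gamma) erefl.

Definition unital_comp (Gamma Delta Theta : unital_graded_algebra)
    (f2 : unital_graded_injective_hom Delta Theta)
    (f1 : unital_graded_injective_hom Gamma Delta) :
  unital_graded_injective_hom Gamma Theta.
Proof.
apply: (@UnitalGradedInjectiveHom _ _ (gr_comp f2 f1)).
by rewrite /= !unital_map1.
Defined.

Definition GrAlg1 : category.
Proof.
apply: (@Category unital_graded_algebra unital_graded_injective_hom
  unital_id unital_comp).
- by move=> *; apply: unital_graded_injective_hom_eq.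
- by move=> *; apply: unital_graded_injective_hom_eq.
- by move=> *; apply: unital_graded_injective_hom_eq.
Defined.

Definition GrAlg1_inclusion : functor GrAlg1 GrAlg.
Proof.
by apply: (@Functor GrAlg1 GrAlg unital_gr unital_map).
Defined.

Section SupportMap.
Variables (Gamma Delta : graded_algebra) (f : graded_injective_hom Gamma Delta).

Lemma gr_map_eq0 g x : Gamma g x -> f x = 0%R -> x = 0%R.
Proof.
move=> gx fx; apply: (@gr_map_inj _ _ f g); rewrite ?inE //.
  by have [] := component_subspace Gamma g.
by rewrite fx raddf0.
Qed.

Lemma supp_map_ex (g : supp Gamma) :
  exists h : supp Delta, f @` Gamma (val g) `<=` Delta (val h).
Proof.
have [h gh] := gr_map_graded f (val g).
have /suppP[x gx x0] := set_valP g.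
have hP : supp Delta h.
  apply/suppP; exists (f x); first by apply: gh; exists x.
  by move/(gr_map_eq0 gx).
by exists (SigSub (mem_set hP)).
Qed.

(* [supp_map_uniq] shows that this choice is the only possible one. *)
Definition supp_map (g : supp Gamma) : supp Delta :=
  projT1 (cid (supp_map_ex g)).

Lemma supp_mapP g : f @` Gamma (val g) `<=` Delta (val (supp_map g)).
Proof. exact: projT2 (cid (supp_map_ex g)). Qed.

Lemma supp_map_uniq (g : supp Gamma) (h : gr_group Delta) :
  f @` Gamma (val g) `<=` Delta h -> val (supp_map g) = h.
Proof.
move=> gh; have /suppP[x gx x0] := set_valP g.
apply: (@component_disjoint _ _ _ Delta _ _ (f x)).
- by apply: supp_mapP; exists x.
- by apply: gh; exists x.
- by move/(gr_map_eq0 gx).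
Qed.

Lemma supp_mapM (g h k : supp Gamma) :
  mul_neq0 Gamma (val g) (val h) -> val k = val g * val h ->
  universal_gen (supp_map k) =
  universal_gen (supp_map g) * universal_gen (supp_map h).
Proof.
move=> [x [y [gx hy xy0]]] kE.
have kxy : Gamma (val k) (amul x y) by rewrite kE; apply: component_mul.
have fx : Delta (val (supp_map g)) (f x) by apply: supp_mapP; exists x.
have fy : Delta (val (supp_map h)) (f y) by apply: supp_mapP; exists y.
have fxy : amul (f x) (f y) <> 0%R.
  by rewrite -gr_mapM => /(gr_map_eq0 kxy).
rewrite /universal_gen -gmulfM; apply/esym/quotient_piP.
set N := normal_closure _; have NP : normal_set N by apply: normal_closureP.
set a := free_gen (supp_map g); set b := free_gen (supp_map h).
set c := free_gen (supp_map k).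
have : N (a * b * c^-1).
  apply: sub_normal_closure.
  exists (supp_map g), (supp_map h), (supp_map k); split=> //.
    by exists (f x), (f y).
  apply: (@component_disjoint _ _ _ Delta _ _ (amul (f x) (f y))) => //.
    by rewrite -gr_mapM; apply: supp_mapP; exists (amul x y).
  exact: component_mul.
move=> /(normalV NP) Nw; have := normalJ NP (a * b) Nw.
by rewrite invgM invgK conjgE mulgVK.
Qed.

Definition universal_group_map :
    group_hom (universal_group Gamma) (universal_group Delta) :=
  universal_lift supp_mapM.

Lemma universal_group_mapE g :
  universal_group_map (universal_gen g) = universal_gen (supp_map g).
Proof. exact: universal_liftE. Qed.

End SupportMap.

Definition R : functor GrAlg Grp.
Proof.
apply: (@Functor GrAlg Grp (fun Gamma => universal_group Gamma)
  universal_group_map).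
- move=> Gamma; apply: universal_hom_ext => g.
  rewrite universal_group_mapE /=; congr universal_gen; apply: val_inj.
  by apply: supp_map_uniq => _ [x gx <-].
- move=> Gamma Delta Theta f2 f1; apply: universal_hom_ext => g.
  rewrite universal_group_mapE.
  rewrite -[RHS]/(universal_group_map f2 (universal_group_map f1 _)).
  rewrite !universal_group_mapE; congr universal_gen; apply: val_inj.
  apply: supp_map_uniq => _ [x gx <-] /=; apply: supp_mapP.
  by exists (f1 x) => //; apply: supp_mapP; exists x.
Defined.

Definition R1 : functor GrAlg1 Grp := functor_comp R GrAlg1_inclusion.

End GradedAlgebras.

(* Main.v *)
Require Import Defs.
From mathcomp Require Import all_boot all_algebra.
From HB Require Import structures.
From mathcomp Require Import boolp classical_sets cardinality fsbigop.

Set Implicit Arguments.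
Unset Strict Implicit.
Unset Printing Implicit Defensive.

Import GRing.Theory.
(* [hom] is again that of categories, not that of vector spaces. *)
Import Defs.

Local Open Scope classical_set_scope.

(** Two facts about groups drive the proof: a trivial homomorphism exists
    between any two groups, and the trivial group, here ['I_1], is
    terminal.

    If [L] is left adjoint to a functor to groups, the first fact makes every
    hom-set from [L G] nonempty ([left_adjoint_hom_exists]).  The zero algebra
    is an object of both categories, and a graded injective homomorphism to it can
    only start from a zero algebra ([zero_of_graded_hom]).  So every [L G] is
    zero.
    - With units required, this is absurd, because the zero algebra has no
      unital homomorphism to [F].
    - Without units, there is exactly one morphism from [L G] to a given object
      [Y], hence exactly one homomorphism from [G] to the universal group of
      [Y].  For [Y] the line with zero multiplication this group is nontrivial
      ([null_universal_group_neq1]), so that its identity and its trivial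
      endomorphism contradict uniqueness.

    If [K] is right adjoint to a functor to groups, then [K 'I_1] is terminal,
    because right adjoints preserve the terminal object
    ([right_adjoint_terminal]).  Put [F * F] in a single degree, and let [f] be
    its morphism to [K 'I_1].  Composing [f] with the exchange of the two factors
    gives [f] again, so [f] takes the same value at [(1, 0)] and [(0, 1)].  But
    [f] is injective on the only component ([graded_hom_swap_neq]).  Everything
    here is unital, so the argument covers both functors. *)

Definition trivial_hom (G H : groupType) : group_hom G H :=
  HB.pack (fun _ : G => 1%g : H)
    (monoid.isMultiplicative.Build G H (fun _ => 1%g)
       (fun _ _ => esym (mulg1 1%g)))
    (Multiplicative_isUMagmaMorphism.Build G H (fun _ => 1%g) erefl).

Section Adjoints.
Variable C : category.

Lemma left_adjoint_hom_exists (S : functor C Grp) (L : functor Grp C) :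
  adjoint L S -> forall G Y, inhabited (hom (L G) Y).
Proof.
move=> [phi [phi_bij _]] G Y; have [psi _ _] := phi_bij G Y.
by split; apply: psi; apply: trivial_hom.
Qed.

Lemma right_adjoint_terminal (S : functor C Grp) (K : functor Grp C) :
  adjoint S K -> forall X,
  inhabited (hom X (K 'I_1)) /\ forall f g : hom X (K 'I_1), f = g.
Proof.
move=> [phi [phi_bij _]] X; have [psi _ psiK] := phi_bij X 'I_1.
split=> [|f g]; first by split; exact: (phi X 'I_1 (trivial_hom _ _)).
apply: (can_inj psiK).
apply: group_hom_eq => x; exact: etrans (ord1 _) (esym (ord1 _)).
Qed.

End Adjoints.

Section TrivialGrading.
Variables (F : fieldType) (A : assocAlgType F).

Lemma trivial_grading_subspace (g : 'I_1) : subspace [set: A].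
Proof. by split. Qed.

Lemma trivial_grading_direct_sum :
  direct_sum_decomposition (fun _ : 'I_1 => [set: A]).
Proof.
move=> x; have sumE (f : 'I_1 -> A) : (\sum_(g \in [set: 'I_1]) f g = f ord0)%R.
  have -> : [set: 'I_1] = [set ord0].
    by apply/seteqP; split=> g //= _; rewrite ord1.
  exact: fsbig_set1.
exists (fun=> x); split=> [|f [_ _ ->]].
  by split=> [//||]; [apply: finite_finset | rewrite sumE].
by apply/funext => g; rewrite sumE (ord1 g).
Qed.

Definition trivial_grading : grading 'I_1 A :=
  @Grading F 'I_1 A (fun=> setT) trivial_grading_subspace
    trivial_grading_direct_sum (fun _ _ _ _ _ _ => I).

Definition trivially_graded : graded_algebra F := GradedAlgebra trivial_grading.

End TrivialGrading.

Section Examples.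
Variable F : fieldType.

(** Taking [n] equal to 0, 1 and 2 gives the zero algebra, [F] and [F * F]. *)
Definition coord_algebra (n : nat) := {ffun 'I_n -> F^o}.

HB.instance Definition _ n := GRing.Lmodule.on (coord_algebra n).

Section Coord.
Variable n : nat.
Implicit Types x y z : coord_algebra n.

Definition coord_mul x y : coord_algebra n := [ffun i => x i * y i]%R.

Lemma coord_mulA : associative coord_mul.
Proof. by move=> x y z; apply/ffunP => i; rewrite !ffunE mulrA. Qed.
Lemma coord_mulDl : left_distributive coord_mul +%R.
Proof. by move=> x y z; apply/ffunP => i; rewrite !ffunE mulrDl. Qed.
Lemma coord_mulDr : right_distributive coord_mul +%R.
Proof. by move=> x y z; apply/ffunP => i; rewrite !ffunE mulrDr. Qed.
Lemma coord_mulZl (c : F) x y : coord_mul (c *: x)%R y = (c *: coord_mul x y)%R.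
Proof. by apply/ffunP => i; rewrite !ffunE; apply: esym (mulrA _ _ _). Qed.
Lemma coord_mulZr (c : F) x y : coord_mul x (c *: y)%R = (c *: coord_mul x y)%R.
Proof. by apply/ffunP => i; rewrite !ffunE; apply: mulrCA. Qed.

HB.instance Definition _ := Lmodule_isAssocAlgebra.Build F (coord_algebra n)
  coord_mulA coord_mulDl coord_mulDr coord_mulZl coord_mulZr.

Lemma coord_oneP : unit_element ([ffun=> 1%R] : coord_algebra n).
Proof. by split=> x; apply/ffunP => i; rewrite !ffunE ?mul1r ?mulr1. Qed.

End Coord.

Definition coord_graded (n : nat) : unital_graded_algebra F :=
  @UnitalGradedAlgebra F (trivially_graded (coord_algebra n)) _ (coord_oneP n).

Definition null_algebra : Type := F^o.

HB.instance Definition _ := GRing.Lmodule.on null_algebra.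

Section Null.
Implicit Types x y : null_algebra.
Definition null_mul x y : null_algebra := 0%R.

Lemma null_mulA : associative null_mul. Proof. by []. Qed.
Lemma null_mulDl : left_distributive null_mul +%R.
Proof. by move=> *; rewrite /null_mul addr0. Qed.
Lemma null_mulDr : right_distributive null_mul +%R.
Proof. by move=> *; rewrite /null_mul addr0. Qed.
Lemma null_mulZl (c : F) x y : null_mul (c *: x)%R y = (c *: null_mul x y)%R.
Proof. by rewrite /null_mul scaler0. Qed.
Lemma null_mulZr (c : F) x y : null_mul x (c *: y)%R = (c *: null_mul x y)%R.
Proof. by rewrite /null_mul scaler0. Qed.

HB.instance Definition _ := Lmodule_isAssocAlgebra.Build F null_algebra
  null_mulA null_mulDl null_mulDr null_mulZl null_mulZr.
End Null.

Definition null_graded : graded_algebra F := trivially_graded null_algebra.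

(** No relator constrains the only generator of this group, as all products
    vanish, so it can be sent to the nonzero element of the integers modulo
    2. *)
Lemma null_universal_group_neq1 :
  exists x : universal_group null_graded, x <> 1%g.
Proof.
have s0 : supp null_graded (ord0 : 'I_1).
  by apply/suppP; exists (1%R : F) => //; apply/eqP/oner_neq0.
have fM (g h k : supp null_graded) :
  mul_neq0 null_graded (val g) (val h) -> val k = (val g * val h)%g ->
  (ord_max : 'I_2) = ((ord_max : 'I_2) * ord_max)%g.
  by move=> [x [y [_ _]]].
exists (universal_gen (SigSub (mem_set s0))) => /(congr1 (universal_lift fM)).
by rewrite universal_liftE gmulf1.
Qed.

(** Injectivity on components is what kills [Gamma]: each component embeds
    into zero. *)
Lemma zero_of_graded_hom (Gamma Delta : graded_algebra F) :
  graded_injective_hom Gamma Delta -> (forall y : gr_algebra Delta, y = 0%R) ->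
  forall x : gr_algebra Gamma, x = 0%R.
Proof.
move=> f Delta0 x; have [a [[ga _ ->] _]] := component_direct_sum Gamma x.
by apply: fsbig1 => g _; apply: (gr_map_eq0 (ga g)); apply: (Delta0 (f _)).
Qed.

Lemma coord0_eq0 (x : coord_algebra 0) : x = 0%R.
Proof. by apply/ffunP => -[]. Qed.

Definition swap_map (x : coord_algebra 2) : coord_algebra 2 :=
  [ffun i => x (rev_ord i)].

Lemma swap_map_is_linear : linear swap_map.
Proof. by move=> c x y; apply/ffunP => i; rewrite !ffunE. Qed.

HB.instance Definition _ :=
  GRing.isLinear.Build F _ _ _ swap_map swap_map_is_linear.

Lemma swap_mapK : involutive swap_map.
Proof. by move=> x; apply/ffunP => i; rewrite !ffunE rev_ordK. Qed.

Definition swap : graded_injective_hom (coord_graded 2) (coord_graded 2).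
Proof.
apply: (@GradedInjectiveHom F (coord_graded 2) (coord_graded 2) swap_map).
- by move=> x y; apply/ffunP => i; rewrite !ffunE.
- by move=> g; exists g.
- by move=> g x y _ _; apply: (can_inj swap_mapK).
Defined.

Definition unital_swap :
  unital_graded_injective_hom (coord_graded 2) (coord_graded 2).
Proof.
apply: (@UnitalGradedInjectiveHom _ _ _ swap).
by apply/ffunP => i; rewrite !ffunE.
Defined.

(** An equality would identify the images of the two primitive idempotents,
    which lie in the same component. *)
Lemma graded_hom_swap_neq (Gamma : graded_algebra F)
    (f : graded_injective_hom (coord_graded 2) Gamma) : gr_comp f swap <> f.
Proof.
pose e : coord_algebra 2 := [ffun i => (i == ord0)%:R]%R.
move=> /(congr1 (fun h : graded_injective_hom (coord_graded 2) Gamma => h e)).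
move=> /(@gr_map_inj _ _ _ f ord0 _ _ (mem_set I) (mem_set I)).
by move=> /ffunP/(_ ord0); rewrite !ffunE => /esym/eqP; rewrite oner_eq0.
Qed.

End Examples.

Theorem theoremB (F : fieldType) :
  (~ has_left_adjoint (R F) /\ ~ has_right_adjoint (R F)) /\
  (~ has_left_adjoint (R1 F) /\ ~ has_right_adjoint (R1 F)).
Proof.
split; split.
- move=> [L LR].
  have [x x1] := null_universal_group_neq1 F.
  pose G : Grp := universal_group (null_graded F).
  have [f] := left_adjoint_hom_exists LR G (coord_graded F 0).
  have L0 := zero_of_graded_hom f (@coord0_eq0 F).
  have [phi [/(_ G (null_graded F)) [psi _ psiK] _]] := LR.
  have : psi (idm G) = psi (trivial_hom _ _).
    by apply: graded_injective_hom_eq => y; rewrite (L0 y) !raddf0.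
  move=> /(can_inj psiK) /(congr1 (fun h : group_hom G G => h x)).
  exact: x1.
- move=> [K RK].
  have [[f] K_uniq] := right_adjoint_terminal RK (coord_graded F 2).
  exact: (graded_hom_swap_neq (K_uniq (gr_comp f (swap F)) f)).
- move=> [L LR].
  have hom_ex Y : inhabited (hom (L 'I_1) Y).
    exact: left_adjoint_hom_exists LR _ Y.
  have [f] := hom_ex (coord_graded F 0).
  have L0 := zero_of_graded_hom f (@coord0_eq0 F).
  have [h] := hom_ex (coord_graded F 1).
  have := unital_map1 h; rewrite (L0 (gr_one _)) raddf0.
  by move=> /ffunP/(_ ord0); rewrite !ffunE => /esym/eqP; rewrite oner_eq0.
- move=> [K RK].
  have [[f] K_uniq] := right_adjoint_terminal RK (coord_graded F 2).
  have := K_uniq (unital_comp f (unital_swap F)) f.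
  by move=> /(congr1 (@unital_map F _ _)) /graded_hom_swap_neq.
Qed.
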